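(* Let $x_i=\frac{p_i}{q_i}$, where $p_i\in\mathbb{Z}$ and $q_i\in\mathbb{N}$ (positive integers) for $i=1,\ldots,n$. Then $$\operatorname{st}_{+}\big(A(x_1,\ldots,x_n)\big)\le 2\left\lceil \log_2\Big(\max_{1\le i\le n} y_i-\min_{1\le i\le n} y_i+1\Big)\right\rceil ,$$ where $y_i=\operatorname{lcm}(q_1,\ldots,q_n)\,x_i$ for $i=1,\ldots,n$.
   Context: For real numbers $x_1,\ldots,x_n$, the associated Euclidean distance matrix is the $n\times n$ symmetric nonnegative matrix $A(x_1,\ldots,x_n):=\big(|x_i-x_j|^2\big)_{i,j=1}^n$. Here $\mathbb{R}_{+}^{m\times n}$ is the set of $m\times n$ real matrices with nonnegative entries and $\mathcal{S}_n^{+}$ is the set of symmetric $n\times n$ matrices with nonnegative entries. For $A\in\mathcal{S}_n^{+}$, an SN-Trifactorization of $A$ is a factorization $A=BCB^{T}$ with $B\in\mathbb{R}_{+}^{n\times k}$ and $C\in\mathcal{S}_k^{+}$; the SNT-rank $\operatorname{st}_{+}(A)$ is the smallest integer $k$ for which such a factorization exists, with the convention $\operatorname{st}_{+}(0)=0$. *)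

(* Defs.v *)
From mathcomp Require Import all_boot all_order all_algebra.
From mathcomp Require Import all_classical all_reals all_analysis.

Set Implicit Arguments.
Unset Strict Implicit.
Unset Printing Implicit Defensive.

Import Order.TTheory GRing.Theory Num.Theory.

Local Open Scope ring_scope.

Definition sym_nneg (R : realType) (n : nat) (A : 'M[R]_n) : Prop :=
  A^T = A /\ A \is a mxOver Num.nneg.

Definition SNT_factorization (R : realType) (n k : nat) (A : 'M[R]_n)
    (B : 'M[R]_(n, k)) (C : 'M[R]_k) : Prop :=
  [/\ B \is a mxOver Num.nneg, sym_nneg C & A = B *m C *m B^T].

Definition has_SNT_factorization (R : realType) (n : nat) (A : 'M[R]_n)
    (k : nat) : Prop :=
  exists (B : 'M[R]_(n, k)) (C : 'M[R]_k), SNT_factorization A B C.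

(* The trivial factorization A = I A I^T of size n. *)
Lemma SNT_factorization_exists (R : realType) (n : nat) (A : 'M[R]_n) :
  sym_nneg A -> exists k : nat, `[< has_SNT_factorization A k >].
Proof.
move=> hA; exists n; apply/asboolP; exists 1%:M, A; split=> //.
  by apply/mxOverP => i j; rewrite mxE nnegrE ler0n.
by rewrite mul1mx trmx1 mulmx1.
Qed.

(* Inner size k = 0 is allowed, which builds in the convention st_+(0) = 0;
   see [snt_rank0]. *)
Definition snt_rank (R : realType) (n : nat) (A : 'M[R]_n)
    (hA : sym_nneg A) : nat :=
  ex_minn (SNT_factorization_exists hA).
Arguments snt_rank {R n} A hA.

Lemma snt_rank0 (R : realType) (n : nat) (h0 : sym_nneg (0 : 'M[R]_n)) :
  snt_rank 0 h0 = 0%N.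
Proof.
rewrite /snt_rank; case: ex_minnP => k _ /(_ 0%N) hk.
apply/eqP; rewrite -leqn0; apply: hk; apply/asboolP; exists 0, 0.
split; first by apply/mxOverP => i [].
- by split; [rewrite trmx0 | apply/mxOverP => -[]].
- by rewrite !mul0mx.
Qed.

Definition edm (R : realType) (n : nat) (x : 'I_n -> R) : 'M[R]_n :=
  \matrix_(i < n, j < n) `|x i - x j| ^+ 2.

Lemma edm_sym_nneg (R : realType) (n : nat) (x : 'I_n -> R) :
  sym_nneg (edm x).
Proof.
split; first by apply/matrixP => i j; rewrite !mxE distrC.
by apply/mxOverP => i j; rewrite mxE nnegrE exprn_ge0.
Qed.

Definition log2 (R : realType) (t : R) : R := ln t / ln 2.

(* Main.v *)
(** Centre a set of 2^(k+1) consecutive integers at the origin and fold it along [t |-> |t|]. Then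
    [(s - t)^2 = (|s| - |t|)^2] when [s], [t] have the same sign, and
    [(s - t)^2 = (|s| - |t|)^2 + 4 |s| |t|] otherwise.
    So the distance matrix is that of the folded points, which take only 2^k consecutive values,
    plus [4 (u v^T + v u^T)] with [u], [v] the positive and negative parts; each folding costs 2. *)
Require Import Defs.
From mathcomp Require Import all_boot all_order all_algebra.
From mathcomp Require Import all_classical all_reals all_analysis.
From mathcomp Require Import zify ring.
Import Order.TTheory GRing.Theory Num.Theory.
Local Open Scope ring_scope.

Lemma has_SNT_factorization0 (R : realType) (n : nat) :
  has_SNT_factorization (0 : 'M[R]_n) 0.
Proof.
exists 0, 0; split; first by apply/mxOverP => i [].
- by split; [rewrite trmx0 | apply/mxOverP => -[]].
- by rewrite !mul0mx.
Qed.

Lemma has_SNT_factorizationD (R : realType) (n k l : nat) (A A' : 'M[R]_n) :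
  has_SNT_factorization A k -> has_SNT_factorization A' l ->
  has_SNT_factorization (A + A') (k + l).
Proof.
move=> [B [C [/mxOverP hB [sC /mxOverP hC] ->]]].
move=> [B' [C' [/mxOverP hB' [sC' /mxOverP hC'] ->]]].
exists (row_mx B B'), (block_mx C 0 0 C'); split.
- by apply/mxOverP => i j; rewrite mxE; case: fintype.split.
- split; first by rewrite tr_block_mx !trmx0 sC sC'.
  apply/mxOverP => i j; rewrite mxE; case: fintype.split => a; rewrite mxE;
    by case: fintype.split => b //; rewrite mxE nnegrE.
- by rewrite mul_row_block tr_row_mx mul_row_col !mulmx0 addr0 add0r.
Qed.

Lemma has_SNT_factorizationZ (R : realType) (n k : nat) (a : R) (A : 'M[R]_n) :
  0 <= a -> has_SNT_factorization A k -> has_SNT_factorization (a *: A) k.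
Proof.
move=> a0 [B [C [hB [sC /mxOverP hC] ->]]].
exists B, (a *: C); split=> //; last by rewrite -scalemxAr -scalemxAl.
split; first by rewrite linearZ /= sC.
by apply/mxOverP => i j; rewrite mxE nnegrE mulr_ge0 // -nnegrE.
Qed.

(** With [u] and [v] as the two columns of the outer factor, the inner factor is the swap matrix of
    order 2, which is symmetric and nonnegative. Hence a folding costs exactly 2 in inner size. *)
Lemma has_SNT_factorization_sym_outer (R : realType) (n : nat) (u v : 'cV[R]_n) :
  u \is a mxOver Num.nneg -> v \is a mxOver Num.nneg ->
  has_SNT_factorization (u *m v^T + v *m u^T) (1 + 1).
Proof.
move=> /mxOverP hu /mxOverP hv.
exists (row_mx u v), (block_mx 0 1%:M 1%:M 0); split.
- by apply/mxOverP => i j; rewrite mxE; case: fintype.split.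
- split; first by rewrite tr_block_mx !trmx0 !trmx1.
  apply/mxOverP => i j; rewrite mxE; case: fintype.split => a; rewrite mxE;
    by case: fintype.split => b //; rewrite mxE nnegrE ?ler0n.
- rewrite mul_row_block tr_row_mx mul_row_col !mulmx0 !mulmx1 addr0 add0r.
  by rewrite addrC.
Qed.

Lemma edm_affine (R : realType) (n : nat) (a b : R) (x : 'I_n -> R) :
  edm (fun i => a * x i + b) = a ^+ 2 *: edm x.
Proof.
apply/matrixP => i j; rewrite !mxE.
by rewrite -!normrX -(ger0_norm (sqr_ge0 a)) -normrM; congr `|_|; ring.
Qed.

Lemma edm_nat_has_SNT_factorization (R : realType) (n k : nat) (m : 'I_n -> nat) :
  (forall i, (m i < 2 ^ k)%N) ->
  has_SNT_factorization (edm (fun i => (m i)%:R : R)) k.*2.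
Proof.
elim: k m => [|k IHk] m hm.
  suff -> : edm (fun i => (m i)%:R : R) = 0 by exact: has_SNT_factorization0.
  apply/matrixP => i j; rewrite !mxE.
  move: (hm i) (hm j); rewrite !expn0 !ltnS !leqn0 => /eqP -> /eqP ->.
  by rewrite subrr normr0 expr0n.
pose low i := (m i < 2 ^ k)%N.
(* Folding about the centre $2^k - 1/2$: the distance from [m i] to it is [m' i] $+ 1/2$, and the
   common $1/2$ cancels in differences. *)
pose m' i := if low i then (2 ^ k - 1 - m i)%N else (m i - 2 ^ k)%N.
have hm' i : (m' i < 2 ^ k)%N.
  by rewrite /m' /low; case: (ltnP (m i)) => h; have := hm i; rewrite expnS; lia.
(* [2 * m' i + 1] is twice the distance from [m i] to the centre [2 ^ k - 1 / 2]. *)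
pose u : 'cV[R]_n := \col_i (if low i then 0 else (2 * m' i + 1)%:R).
pose v : 'cV[R]_n := \col_i (if low i then (2 * m' i + 1)%:R else 0).
(* Since [u] and [v] hold doubled distances, their products already contain the factor 4 of the
   cross term. As their supports are the two sides of the centre, the correction vanishes for points
   on the same side. *)
have -> : edm (fun i => (m i)%:R : R) =
    edm (fun i => (m' i)%:R) + (u *m v^T + v *m u^T).
  have E i : (m i)%:R = (if low i then (2 ^ k)%:R - 1 - (m' i)%:R
                         else (2 ^ k)%:R + (m' i)%:R) :> R.
    rewrite /m' /low; case: (ltnP (m i)) => h; last by rewrite -natrD subnKC.
    by rewrite !natrB ?expn_gt0 //; [ring | lia].
  apply/matrixP => i j; rewrite !mxE !big_ord1 !mxE !E.
  rewrite !real_normK ?num_real //.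
  by case: (low i); case: (low j); ring.
rewrite doubleS -addn2 -(addn1 1); apply: has_SNT_factorizationD; first exact: IHk.
by apply: has_SNT_factorization_sym_outer; apply/mxOverP => i j;
  rewrite mxE nnegrE; case: ifP => _; rewrite ?ler0n.
Qed.

Lemma snt_rank_le (R : realType) (n k : nat) (A : 'M[R]_n) (hA : sym_nneg A) :
  has_SNT_factorization A k -> (snt_rank A hA <= k)%N.
Proof.
by move=> hk; rewrite /snt_rank; case: ex_minnP => l _; apply; apply/asboolP.
Qed.

(** The default [y ord0] is itself a value of [y], and a binary minimum returns one of its
    arguments. An attained minimum can serve as an integer origin for the scaled points. *)
Lemma bigmin_attained (R : realType) (n : nat) (y : 'I_n.+1 -> R) :
  exists i0, \big[Num.min/y ord0]_(i < n.+1) y i = y i0.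
Proof.
apply: (big_ind (fun z => exists i0, z = y i0)) => [|a b [i ->] [j ->]|i _].
- by exists ord0.
- by case: leP => _; [exists i | exists j].
- by exists i.
Qed.

(** For $t \ge 1$ the logarithm is nonnegative, so its ceiling is a natural number and can count
    foldings. *)
Lemma ceil_log2_exp (R : realType) (t : R) :
  1 <= t -> exists2 k : nat, Num.ceil (log2 t) = k%:Z & t <= 2 ^+ k.
Proof.
move=> t1; have ln2 : 0 < ln 2 :> R by rewrite ln_gt0 // ltr1n.
have log_ge0 : 0 <= log2 t by rewrite divr_ge0 ?ln_ge0 ?ler1n.
have ceil_ge0 : 0 <= Num.ceil (log2 t).
  by rewrite ceil_ge0 (lt_le_trans _ log_ge0) // ltrN10.
exists `|Num.ceil (log2 t)|%N; first by rewrite gez0_abs.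
have t0 : 0 < t by exact: lt_le_trans ltr01 t1.
rewrite -ler_ln ?posrE ?exprn_gt0 ?ltr0n //.
rewrite lnXn ?ltr0n // -(mulr_natl (ln 2)) -ler_pdivrMr // natr_absz ger0_norm //.
exact: ceil_ge.
Qed.

Theorem corollary4p4 (R : realType) (n : nat)
    (p : 'I_n.+1 -> int) (q : 'I_n.+1 -> nat) (x y : 'I_n.+1 -> R)
    (hq : forall i, (0 < q i)%N)
    (hx : forall i, x i = (p i)%:~R / (q i)%:R)
    (hy : forall i, y i = (\big[lcmn/1%N]_(j < n.+1) q j)%:R * x i) :
  ((snt_rank (edm x) (edm_sym_nneg x))%:Z <=
    2 * Num.ceil (log2 (\big[Num.max/y ord0]_(i < n.+1) y i
                        - \big[Num.min/y ord0]_(i < n.+1) y i + 1)))%R.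
Proof.
have maxP i : y i <= \big[Num.max/y ord0]_(i < n.+1) y i by exact: le_bigmax.
have minP i : \big[Num.min/y ord0]_(i < n.+1) y i <= y i by exact: bigmin_le.
have [i0 min_i0] := @bigmin_attained R n y.
move: maxP minP; set M := (\big[Num.max/_]_(i < _) _); rewrite min_i0 => maxP minP.
set L := (\big[lcmn/1%N]_(j < n.+1) q j) in hy.
have L0 : L%:R != 0 :> R.
  rewrite pnatr_eq0 -lt0n /L.
  by elim/big_ind: _ => // a b a0 b0; rewrite lcmn_gt0 a0.
(* Each [q i] divides [L], so $L p_i / q_i$ is an integer. *)
pose c i : int := (L %/ q i)%:Z * p i.
have y_int i : y i = (c i)%:~R.
  have qL : (q i %| L)%N by apply: (biglcmn_sup i).
  have qi0 : (q i)%:R != 0 :> R by rewrite pnatr_eq0 -lt0n.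
  rewrite hy hx /c -{1}(divnK qL) natrM intrM.
  by rewrite mulrA (mulrAC _ (q i)%:R) mulfK.
(* As [y i0] is the minimum, the absolute value changes nothing: [m i] is the offset of [y i] from
   it. *)
pose m i := absz (c i - c i0).
have mE i : (m i)%:R = y i - y i0.
  by rewrite /m natr_absz intr_norm intrB -!y_int ger0_norm // subr_ge0.
have [|k -> hk] := @ceil_log2_exp R (M - y i0 + 1).
  by rewrite lerDr subr_ge0.
(* The $+1$ under the logarithm gives the strict bound: [m i] $+ 1 \le$ [M - y i0 + 1] $\le 2^k$. *)
have m_lt i : (m i < 2 ^ k)%N.
  rewrite -addn1 -(ler_nat R) natrD natrX mE.
  by apply: le_trans hk; rewrite lerD2r lerD2r.
have -> : 2 * k%:Z = k.*2 by rewrite -mul2n.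
rewrite lez_nat; apply: snt_rank_le.
(* The original points are recovered as $x_i = L^{-1} m_i + x_{i_0}$. *)
have -> : edm x = (L%:R^-1) ^+ 2 *: edm (fun i => (m i)%:R).
  rewrite -(@edm_affine R n.+1 _ (x i0)); congr edm; apply/funext => i.
  by rewrite mE !hy -mulrBr mulKf // subrK.
apply: has_SNT_factorizationZ; first exact: sqr_ge0.
exact: edm_nat_has_SNT_factorization.
Qed.
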